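(* Let $n\ge1$ and $0\le k\le n(n-1)/2$. A pattern $P$ satisfies $P\in\gamma(P_{n,k})$ if and only if $\varphi(P)=T_n$ and $e(P)=k$.
   Context: A pattern is a finite subset $P\subset\mathbb{Z}^2$. Let $T=\{(0,1),(1,1),(1,0)\}$ and $T_n=\{(a,b)\in\{0,\ldots,n-1\}^2 : a+b\geq n-1\}$. A solitaire move applies to $P$ at $v$ when $|P\cap(v+T)|=2$ and replaces $P$ by $(P\setminus(v+T))\cup S$ for an arbitrary two-element $S\subset v+T$; $\gamma(P)$ is the set of patterns reachable by finitely many moves. The filling $\varphi(P)$ is obtained by repeatedly adding a point $w$ whenever there is $v$ with $|P\cap(v+T)|=2$ (current set) and $w\in v+T$, until stable. With $N(x)=\{x\pm(1,0),x\pm(0,1),x\pm(1,-1)\}$ and $N(A)=\bigcup_{x\in A}N(x)$, the filling decomposes uniquely (up to order) as $\varphi(P)=\bigcup_{i=1}^r(v_i+T_{k_i})$ with $N(v_i+T_{k_i})\cap(v_j+T_{k_j})=\varnothing$ for $i\ne j$; the excess is $e(P)=|P|-\sum_i k_i$. The pattern $P_{n,k}$ consists of the top row $\{(a,n-1):0\le a\le n-1\}$ of $T_n$ together with the first $k$ points of $T_n\setminus\{(a,n-1)\}$ in the order that lists rows from top to bottom (decreasing second coordinate) and, within each row, points from right to left (decreasing first coordinate). *)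

(* Defs.v *)
From Stdlib Require Import Relation_Operators ClassicalEpsilon.
From HB Require Import structures.
From mathcomp Require Import all_boot all_order all_algebra finmap zify.

Set Implicit Arguments.
Unset Strict Implicit.
Unset Printing Implicit Defensive.

Import GRing.Theory.
Local Open Scope fset_scope.
Local Open Scope ring_scope.

Notation point := (int * int)%type.
Notation pattern := {fset point}.

Definition translate (v : point) (A : pattern) : pattern := [fset v + x | x in A].

Definition T : pattern := [fset (0, 1); (1, 1); (1, 0)].

Definition Tn (n : nat) : pattern :=
  [fset x in [seq (a%:Z, b%:Z) | a <- iota 0 n, b <- iota 0 n]
     | n%:Z - 1 <= x.1 + x.2].

Definition solitaire_move (P Q : pattern) : Prop :=
  exists v S, [/\ #|` P `&` translate v T | = 2%N, S `<=` translate v T, #|` S | = 2%N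
    & Q = (P `\` translate v T) `|` S].

Definition gamma (P Q : pattern) : Prop := clos_refl_trans pattern solitaire_move P Q.

Definition fill_step (P Q : pattern) : Prop :=
  exists v w, [/\ #|` P `&` translate v T | = 2%N, w \in translate v T & Q = w |` P].

Definition stable (P : pattern) : Prop := forall v, #|` P `&` translate v T | <> 2%N.

(* The filling does not depend on the order of the steps: filling_unique and
   fillingP below show that filling P is the only set satisfying is_filling P. *)
Definition is_filling (P F : pattern) : Prop :=
  clos_refl_trans pattern fill_step P F /\ stable F.

Definition filling (P : pattern) : pattern := epsilon (inhabits fset0) (is_filling P).

Definition nbrs (x : point) : pattern :=
  [fset x + (1, 0); x - (1, 0); x + (0, 1); x - (0, 1); x + (1, -1); x - (1, -1)].

Definition nbrs_set (A : pattern) : pattern := \bigcup_(x <- A) nbrs x.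

Definition triangle (t : point * nat) : pattern := translate t.1 (Tn t.2).

(* A pair (v, k) stands for v + T_k. Empty triangles are excluded, and the family is a
   set: the separation condition alone would let a singleton v + T_1 be listed twice,
   since x is not a member of N(x). Existence and uniqueness for fillings are
   decompositionP and decomposition_unique below. *)
Definition is_decomposition (F : pattern) (D : {fset point * nat}) : Prop :=
  [/\ F = \bigcup_(t <- D) triangle t,
      forall t, t \in D -> (0 < t.2)%N
    & forall s t, s \in D -> t \in D -> s <> t ->
        nbrs_set (triangle s) `&` triangle t = fset0].

Definition decomposition (F : pattern) : {fset point * nat} :=
  epsilon (inhabits fset0) (is_decomposition F).

Definition excess (P : pattern) : int :=
  #|` P |%:Z - (\sum_(t <- decomposition (filling P)) t.2)%N%:Z.

Definition top_row (n : nat) : pattern := [fset x in [seq (a%:Z, n%:Z - 1) | a <- iota 0 n]].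

Definition below_top (n : nat) : seq point :=
  [seq x <- [seq (a%:Z, b%:Z) | b <- rev (iota 0 n.-1), a <- rev (iota 0 n)] | x \in Tn n].

Definition Pnk (n k : nat) : pattern := top_row n `|` [fset x in take k (below_top n)].

Lemma in_translate v A x : (x \in translate v A) = (x - v \in A).
Proof.
apply/imfsetP/idP => [[y /= yA ->]|h]; first by rewrite addrC addKr.
by exists (x - v) => //=; rewrite addrC subrK.
Qed.

Lemma in_translateT (v x : point) : (x \in translate v T) =
  [|| (x.1 == v.1) && (x.2 == v.2 + 1), (x.1 == v.1 + 1) && (x.2 == v.2 + 1)
    | (x.1 == v.1 + 1) && (x.2 == v.2)].
Proof.
rewrite in_translate !inE /=; case: x v => [a b] [c d] /=.
by rewrite !xpair_eqE /=; lia.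
Qed.

Lemma in_Tn n (x : point) : (x \in Tn n) =
  [&& 0 <= x.1, x.1 <= n%:Z - 1, 0 <= x.2, x.2 <= n%:Z - 1 & n%:Z - 1 <= x.1 + x.2].
Proof.
rewrite !inE /=; case: x => [a b] /=.
apply/andP/idP => [[/allpairsP[[i j] /= [] ]]|].
  rewrite !mem_iota => hi hj [-> ->] h; lia.
case: a => [a|a]; case: b => [b|b] h; try lia.
split; last lia.
by apply/allpairsP; exists (a, b); rewrite /= !mem_iota; split => //; lia.
Qed.

Lemma in_triangle (t : point * nat) (x : point) : (x \in triangle t) =
  [&& t.1.1 <= x.1, x.1 <= t.1.1 + t.2%:Z - 1, t.1.2 <= x.2,
      x.2 <= t.1.2 + t.2%:Z - 1 & t.1.1 + t.1.2 + t.2%:Z - 1 <= x.1 + x.2].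
Proof.
rewrite in_translate in_Tn; case: x t => [a b] [[c d] n] /=; lia.
Qed.

Lemma in_nbrs (x y : point) : (y \in nbrs x) =
  [|| (y.1 == x.1 + 1) && (y.2 == x.2), (y.1 == x.1 - 1) && (y.2 == x.2),
      (y.1 == x.1) && (y.2 == x.2 + 1), (y.1 == x.1) && (y.2 == x.2 - 1),
      (y.1 == x.1 + 1) && (y.2 == x.2 - 1) | (y.1 == x.1 - 1) && (y.2 == x.2 + 1)].
Proof.
rewrite !inE /=; case: x y => [a b] [c d] /=; rewrite !xpair_eqE /=; lia.
Qed.

Lemma in_bigcup (I : choiceType) (D : {fset I}) (f : I -> pattern) (x : point) :
  reflect (exists2 i, i \in D & x \in f i) (x \in \bigcup_(i <- D) f i).
Proof.
apply: (iffP (bigfcupP _ _ _ _)) => [[i]|[i iD xi]]; first by rewrite andbT; exists i.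
by exists i; rewrite ?andbT.
Qed.

Lemma card_T v : #|` translate v T | = 3%N.
Proof.
rewrite card_imfset; last exact: addrI.
by rewrite /T fsetUC !cardfsU1 cardfs1 !inE !xpair_eqE.
Qed.

Lemma card_gt1 (A : pattern) :
  (1 < #|` A |)%N -> exists x y, [/\ x \in A, y \in A & x != y].
Proof.
move=> h; have /fset0Pn[x xA] : A != fset0 by rewrite -cardfs_gt0; lia.
have /fset0Pn[y] : A `\ x != fset0.
  by rewrite -cardfs_gt0; move: h; rewrite (cardfsD1 x A) xA; lia.
by rewrite !inE => /andP[yx yA]; exists x, y; rewrite eq_sym.
Qed.

Lemma stableP F : stable F <-> forall v x y z : point, [/\ x \in translate v T, y \in translate v T
  & z \in translate v T] -> x <> y -> x \in F -> y \in F -> z \in F.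
Proof.
split=> [sF v x y z [xT yT zT] xy xF yF | H v h].
  apply: contraT => zF; case: (sF v).
  have le2: (2 <= #|` F `&` translate v T |)%N.
    have -> : 2%N = #|` [fset x; y] | by rewrite cardfs2; case: eqP xy.
    apply: fsubset_leq_card; apply/fsubsetP => u; rewrite !inE.
    by case/orP => /eqP ->; apply/andP.
  have lt3: (#|` F `&` translate v T | < #|` translate v T |)%N.
    apply: fproper_ltn_card; apply: fproperIr; apply/fsubsetPn.
    by exists z.
  by move: lt3; rewrite card_T; lia.
have /card_gt1 : (1 < #|` F `&` translate v T |)%N by rewrite h.
case=> x [y] []; rewrite !inE => /andP[xF xT] /andP[yF yT] /eqP xy.
suff E : F `&` translate v T = translate v T by move: h; rewrite E card_T.
apply/fsetP => z; rewrite inE; case zT: (z \in translate v T); rewrite ?andbF // andbT.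
exact: (H v x y).
Qed.

Lemma fill_step_sub P Q F : fill_step P Q -> stable F -> P `<=` F -> Q `<=` F.
Proof.
case=> v [w] [h wT ->] /stableP H /fsubsetP PF.
apply/fsubsetP => u; rewrite !inE => /orP[/eqP ->|/PF //].
have /card_gt1 : (1 < #|` P `&` translate v T |)%N by rewrite h.
case=> x [y] []; rewrite !inE => /andP[xF xT] /andP[yF yT] /eqP xy.
by apply: (H v x y) => //; apply: PF.
Qed.

Lemma fill_sub P Q F :
  clos_refl_trans pattern fill_step P Q -> stable F -> P `<=` F -> Q `<=` F.
Proof.
by move=> PQ sF; elim: PQ => [A B /fill_step_sub|A|A B C _ h1 _ h2 /h1] //; apply.
Qed.

Lemma fill_incr P Q : clos_refl_trans pattern fill_step P Q -> P `<=` Q.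
Proof.
elim=> [A B [v [w [_ _ ->]]]|A|A B C _ h1 _]; first exact: fsubsetU1.
  exact: fsubset_refl.
exact: fsubset_trans.
Qed.

Lemma filling_unique P F G : is_filling P F -> is_filling P G -> F = G.
Proof.
move=> [PF sF] [PG sG]; apply/eqP; rewrite eqEfsubset.
by rewrite (fill_sub PF sG (fill_incr PG)) (fill_sub PG sF (fill_incr PF)).
Qed.

Lemma stable_triangle t : stable (triangle t).
Proof.
apply/stableP => v x y z []; rewrite !in_translateT !in_triangle => hx hy hz xy.
have {}xy : x.1 <> y.1 \/ x.2 <> y.2.
  have [E1|] := eqVneq x.1 y.1; last by move/eqP; left.
  by right=> E2; apply: xy; apply/eqP; rewrite -pair_eqE /pair_eq E1 E2 !eqxx.
move=> hxt hyt; move: hx hy hz xy hxt hyt.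
case: x y z v t => [x1 x2] [y1 y2] [z1 z2] [v1 v2] [[a b] k] /=.
do 3!(case/or3P=> /andP[/eqP-> /eqP->]); lia.
Qed.

Lemma sub_triangle (P : pattern) : exists t, P `<=` triangle t.
Proof.
suff [m H] : exists m : nat, forall x : point, x \in (P : seq point) -> (`|x.1| <= m%:Z) && (`|x.2| <= m%:Z).
  exists ((- (3 * m)%N%:Z, - (3 * m)%N%:Z), (4 * m + 1)%N).
  apply/fsubsetP => x /H; rewrite in_triangle /=; lia.
elim: (P : seq point) => [|y s [m IH]]; first by exists 0%N.
exists (maxn m (maxn `|y.1|%N `|y.2|%N)) => x; rewrite inE => /orP[/eqP ->|/IH]; lia.
Qed.

Lemma filling_exists P : exists F, is_filling P F.
Proof.
have [t Pt] := sub_triangle P.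
elim: {P}_.+1 {-2}P (ltnSn (#|` triangle t | - #|` P |)) Pt => // m IH P hm Pt.
have [sP|nP] := excluded_middle_informative (stable P).
  by exists P; split=> //; apply: rt_refl.
have [v [w [h wT wP]]] : exists v w, [/\ #|` P `&` translate v T | = 2%N, w \in translate v T & w \notin P].
  apply: Classical_Prop.NNPP => nex; apply: nP => v h; apply: nex.
  have /fsubsetPn[w wT wP] : ~~ (translate v T `<=` P).
    by apply/negP => /fsetIidPr E; move: h; rewrite E card_T.
  by exists v, w.
have st : fill_step P (w |` P) by exists v, w.
have sub := fill_step_sub st (@stable_triangle t) Pt.
have [] := IH (w |` P) _ sub.
  have := fsubset_leq_card sub; move: hm; rewrite cardfsU1 wP; lia.
move=> F [PF sF]; exists F; split=> //; apply: rt_trans PF; exact: rt_step.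
Qed.

Lemma fillingP P : is_filling P (filling P).
Proof. exact: epsilon_spec (filling_exists P). Qed.

Lemma in_nbrs_set A (y : point) : reflect (exists2 x : point, x \in A & y \in nbrs x) (y \in nbrs_set A).
Proof. exact: in_bigcup. Qed.

Lemma triangle_nbr_ind (t : point * nat) (B : point -> Prop) (x : point) :
  x \in triangle t -> B x ->
  (forall y z : point, y \in triangle t -> B y -> z \in triangle t -> z \in nbrs y -> B z) ->
  forall y : point, y \in triangle t -> B y.
Proof.
move=> xt Bx step.
pose c : point := (t.1.1 + t.2%:Z - 1, t.1.2 + t.2%:Z - 1).
have nb (y : point) : y \in triangle t -> y = c \/ exists z : point, [/\ z \in triangle t, z \in nbrs y,
    y \in nbrs z & (`|c.1 - z.1| + `|c.2 - z.2| < `|c.1 - y.1| + `|c.2 - y.2|)%N].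
  move=> yt; have [h1|h1] : y.1 < c.1 \/ c.1 <= y.1 by lia.
    right; exists (y.1 + 1, y.2); rewrite !in_nbrs /=; move: yt h1.
    by rewrite !in_triangle /c /=; split; lia.
  have [h2|h2] : y.2 < c.2 \/ c.2 <= y.2 by lia.
    right; exists (y.1, y.2 + 1); rewrite !in_nbrs /=; move: yt h2.
    by rewrite !in_triangle /c /=; split; lia.
  left; move: yt h1 h2; rewrite in_triangle /c; case: y => [a b] /= yt h1 h2.
  by congr pair; lia.
have Bc : B c.
  have [m] := ubnP (`|c.1 - x.1| + `|c.2 - x.2|)%N.
  elim: m x xt Bx => // m IH x xt Bx hm.
  have [<- //|[z [zt zx xz lt]]] := nb x xt.
  by apply: (IH z) => //; [exact: step zx|lia].
move=> y yt.
have [m] := ubnP (`|c.1 - y.1| + `|c.2 - y.2|)%N.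
elim: m y yt => // m IH y yt hm.
have [-> //|[z [zt zy yz lt]]] := nb y yt.
by apply: (step z) => //; apply: IH => //; lia.
Qed.

Lemma triangle_inj (s t : point * nat) : (0 < s.2)%N -> triangle s = triangle t -> s = t.
Proof.
move=> s0 E.
have H (x : point) : (x \in triangle s) = (x \in triangle t) by rewrite E.
case: s t s0 {E} H => [[a b] n] [[c d] m] /= n0 H.
have m0 : (0 < m)%N.
  have := H (a + n%:Z - 1, b + n%:Z - 1); rewrite !in_triangle /=; lia.
have H1 : (a + n%:Z - 1, b) \in triangle ((c, d), m) by rewrite -H in_triangle /=; lia.
have H2 : (a, b + n%:Z - 1) \in triangle ((c, d), m) by rewrite -H in_triangle /=; lia.
have K1 : (c + m%:Z - 1, d) \in triangle ((a, b), n) by rewrite H in_triangle /=; lia.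
have K2 : (c, d + m%:Z - 1) \in triangle ((a, b), n) by rewrite H in_triangle /=; lia.
move: H1 H2 K1 K2 {H}; rewrite !in_triangle /=.
case/and5P=> a1 a2 a3 a4 a5; case/and5P=> b1 b2 b3 b4 b5.
case/and5P=> c1 c2 c3 c4 c5; case/and5P=> d1 d2 d3 d4 d5.
have -> : a = c by lia.
have -> : b = d by lia.
have -> : n = m by lia.
by [].
Qed.

Lemma triangle_neq0 (t : point * nat) : (0 < t.2)%N -> exists x : point, x \in triangle t.
Proof. by move=> h; exists (t.1.1 + t.2%:Z - 1, t.1.2 + t.2%:Z - 1); rewrite in_triangle /=; lia. Qed.

Lemma triangle_sub_decomposition F D (t : point * nat) : is_decomposition F D -> (0 < t.2)%N ->
  triangle t `<=` F -> exists2 s, s \in D & triangle t `<=` triangle s.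
Proof.
case=> -> D0 sep t0 /fsubsetP tF.
have [x xt] := triangle_neq0 t0.
have /in_bigcup[s sD xs] := tF x xt.
exists s => //; apply/fsubsetP => y; move: y.
apply: (triangle_nbr_ind xt xs) => y z yt ys zt zy.
have /in_bigcup[u uD zu] := tF z zt.
have [<- //|/eqP ne] := eqVneq u s.
have : z \in nbrs_set (triangle s) `&` triangle u.
  by rewrite inE zu andbT; apply/in_nbrs_set; exists y.
by rewrite sep // => E; apply: ne.
Qed.

Lemma decomposition_maximal F D (s t : point * nat) : is_decomposition F D -> s \in D -> t \in D ->
  triangle s `<=` triangle t -> s = t.
Proof.
case=> _ D0 sep sD tD /fsubsetP st.
apply: Classical_Prop.NNPP => ne.
have s0 := D0 _ sD; have t0 := D0 _ tD.
have [x xs] := triangle_neq0 s0.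
have [y yt yx] : exists2 y, y \in triangle t & y \notin triangle s.
  apply: Classical_Prop.NNPP => nex; apply: ne; apply: triangle_inj => //.
  apply/fsetP => y; apply/idP/idP => [/st //|yt].
  by apply: contraT => ys; case: nex; exists y.
move/negP: yx; apply; move: y yt.
apply: (triangle_nbr_ind (B := fun y => y \in triangle s) (st _ xs) xs).
move=> u z ut us zt zu.
have : z \in nbrs_set (triangle s) `&` triangle t.
  by rewrite inE zt andbT; apply/in_nbrs_set; exists u.
by rewrite sep.
Qed.

Lemma decomposition_unique F D E : is_decomposition F D -> is_decomposition F E -> D = E.
Proof.
have main D1 D2 : is_decomposition F D1 -> is_decomposition F D2 -> D1 `<=` D2.
  move=> d1 d2; apply/fsubsetP => t tD.
  have sub (A : {fset point * nat}) u : is_decomposition F A -> u \in A -> triangle u `<=` F.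
    by case=> -> _ _ uA; apply/fsubsetP => x xu; apply/in_bigcup; exists u.
  have pos (A : {fset point * nat}) u : is_decomposition F A -> u \in A -> (0 < u.2)%N.
    by case=> _ h _ /h.
  have [s sD ts] := triangle_sub_decomposition d2 (pos _ _ d1 tD) (sub _ _ d1 tD).
  have [u uD su] := triangle_sub_decomposition d1 (pos _ _ d2 sD) (sub _ _ d2 sD).
  have tu : t = u := decomposition_maximal d1 tD uD (fsubset_trans ts su).
  rewrite (triangle_inj (pos _ _ d1 tD) (t := s)) //; apply/eqP.
  by rewrite eqEfsubset ts tu su.
by move=> dD dE; apply/eqP; rewrite eqEfsubset !main.
Qed.

Lemma zind (p : int) (m : nat) (B : int -> Prop) q : p <= q -> q <= p + m%:Z -> B q ->
  (forall r, p <= r -> r < p + m%:Z -> (B r <-> B (r + 1))) ->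
  forall r, p <= r -> r <= p + m%:Z -> B r.
Proof.
move=> h1 h2 Bq H.
have Bp : B p.
  have : exists i : nat, q = p + i%:Z by exists `|q - p|%N; lia.
  case=> i E; move: Bq h2; rewrite {q h1}E; elim: i => [|i IH]; first by rewrite addr0.
  have -> : p + i.+1%:Z = p + i%:Z + 1 by lia.
  by move=> h h2; apply: IH; [apply/H => //; lia|lia].
move=> r hr hr2; have : exists i : nat, r = p + i%:Z by exists `|r - p|%N; lia.
case=> i E; move: hr2; rewrite {r hr}E; elim: i => [|i IH]; first by rewrite addr0.
have -> : p + i.+1%:Z = p + i%:Z + 1 by lia.
by move=> h; have [||+ _] := H (p + i%:Z); [lia|lia|apply; apply: IH; lia].
Qed.

Lemma extend_triangle F (t : point * nat) (y : point) : stable F -> (0 < t.2)%N -> triangle t `<=` F -> y \in F ->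
  y \in nbrs_set (triangle t) -> y \notin triangle t ->
  exists s : point * nat, [/\ t.2 < s.2, triangle t `<=` triangle s & triangle s `<=` F]%N.
Proof.
move=> /stableP sF t0 /fsubsetP tF yF /in_nbrs_set[x xt]; move: xt.
case: t t0 tF => [[a b] k] /= k0 tF.
have clos (c d : int) x1 x2 y1 y2 z1 z2 : (x1, x2) <> (y1, y2) ->
    [/\ (x1, x2) \in translate (c, d) T, (y1, y2) \in translate (c, d) T
      & (z1, z2) \in translate (c, d) T] ->
    (x1, x2) \in F -> (y1, y2) \in F -> (z1, z2) \in F.
  by move=> ne h; apply: (sF (c, d)).
have nepair (i j i' j' : int) : (i != i') || (j != j') -> (i, j) <> (i', j').
  by move=> h [E1 E2]; move: h; rewrite E1 E2 !eqxx.
case: x y yF => [x1 x2] [y1 y2] yF; rewrite in_nbrs !in_triangle /= => xt ny yt.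
have [Hr|[Hu|Hd]] : y1 = a + k%:Z \/ y2 = b + k%:Z \/ y1 + y2 = a + b + k%:Z - 2.
- by move: xt ny yt; lia.
- exists ((a, b - 1), k.+1); rewrite /=; split=> //.
    by apply/fsubsetP => z; rewrite !in_triangle /=; lia.
  have col : forall r, b - 1 <= r -> r <= b - 1 + k%:Z -> (a + k%:Z, r) \in F.
    apply: (@zind _ _ (fun r => (a + k%:Z, r) \in F) y2); [lia|lia|by rewrite -Hr|].
    move=> r h1 h2; have h : (a + k%:Z - 1, r + 1) \in F by apply: tF; rewrite in_triangle /=; lia.
    split=> h'; apply: (clos (a + k%:Z - 1) r _ _ _ _ _ _ _ _ h h'); try (apply: nepair; lia);
      by rewrite !in_translateT /=; split; lia.
  apply/fsubsetP => -[z1 z2] zt; have [E|ne] := eqVneq z1 (a + k%:Z).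
    by rewrite E; apply: col; move: zt; rewrite in_triangle /=; lia.
  by apply: tF; move: zt ne; rewrite !in_triangle /=; lia.
- exists ((a - 1, b), k.+1); rewrite /=; split=> //.
    by apply/fsubsetP => z; rewrite !in_triangle /=; lia.
  have col : forall r, a - 1 <= r -> r <= a - 1 + k%:Z -> (r, b + k%:Z) \in F.
    apply: (@zind _ _ (fun r => (r, b + k%:Z) \in F) y1); [lia|lia|by rewrite -Hu|].
    move=> r h1 h2; have h : (r + 1, b + k%:Z - 1) \in F by apply: tF; rewrite in_triangle /=; lia.
    split=> h'; apply: (clos r (b + k%:Z - 1) _ _ _ _ _ _ _ _ h h'); try (apply: nepair; lia);
      by rewrite !in_translateT /=; split; lia.
  apply/fsubsetP => -[z1 z2] zt; have [E|ne] := eqVneq z2 (b + k%:Z).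
    by rewrite E; apply: col; move: zt; rewrite in_triangle /=; lia.
  by apply: tF; move: zt ne; rewrite !in_triangle /=; lia.
- exists ((a - 1, b - 1), k.+1); rewrite /=; split=> //.
    by apply/fsubsetP => z; rewrite !in_triangle /=; lia.
  have col : forall r, a - 1 <= r -> r <= a - 1 + k%:Z -> (r, a + b + k%:Z - 2 - r) \in F.
    apply: (@zind _ _ (fun r => (r, a + b + k%:Z - 2 - r) \in F) y1); [lia|lia| |].
      by have <- : y2 = a + b + k%:Z - 2 - y1 by lia.
    move=> r h1 h2.
    have h : (r + 1, a + b + k%:Z - 2 - r) \in F by apply: tF; rewrite in_triangle /=; lia.
    split=> h'; apply: (clos r (a + b + k%:Z - 3 - r) _ _ _ _ _ _ _ _ h h');
      try (apply: nepair; lia); by rewrite !in_translateT /=; split; lia.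
  apply/fsubsetP => -[z1 z2] zt; have [E|ne] := eqVneq (z1 + z2) (a + b + k%:Z - 2).
    have -> : z2 = a + b + k%:Z - 2 - z1 by lia.
    by apply: col; move: zt; rewrite in_triangle /=; lia.
  by apply: tF; move: zt ne; rewrite !in_triangle /=; lia.
Qed.

Lemma triangle_size F (t : point * nat) : triangle t `<=` F -> (t.2 <= #|` F |)%N.
Proof.
move=> h; apply: leq_trans (fsubset_leq_card h).
pose R : pattern := [fset (t.1.1 + i%:Z, t.1.2 + t.2%:Z - 1) | i in iota 0 t.2].
have <- : #|` R | = t.2.
  rewrite card_imfset /=; last by move=> i j [] /eqP; lia.
  by rewrite undup_id ?iota_uniq // size_iota.
apply: fsubset_leq_card; apply/fsubsetP => x /imfsetP[i /= ]; rewrite mem_iota => hi ->.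
by rewrite in_triangle /=; lia.
Qed.

Lemma decomposition_exists F : stable F -> exists D, is_decomposition F D.
Proof.
move=> sF.
pose cand := [seq (p, i) | p <- [seq (x.1, y.2) | x <- (F : seq point), y <- (F : seq point)],
                           i <- iota 1 #|` F |].
have candP (t : point * nat) : (0 < t.2)%N -> triangle t `<=` F -> t \in cand.
  move=> t0 tF; apply/allpairsP; exists (t.1, t.2) => /=; split; last by case: (t).
    apply/allpairsP; exists ((t.1.1, t.1.2 + t.2%:Z - 1), (t.1.1 + t.2%:Z - 1, t.1.2)) => /=.
    split; last by case: (t) => [[]].
      by apply: (fsubsetP tF); rewrite in_triangle /=; lia.
    by apply: (fsubsetP tF); rewrite in_triangle /=; lia.
  by rewrite mem_iota t0 add1n ltnS; exact: triangle_size.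
pose mx (t : point * nat) := [&& (0 < t.2)%N, triangle t `<=` F
  & all (fun s : point * nat => (triangle s `<=` F) ==> (triangle t `<=` triangle s) ==> (s.2 <= t.2)%N) cand].
have mxP t (y : point) : mx t -> y \in F -> y \in nbrs_set (triangle t) -> y \in triangle t.
  case/and3P=> t0 tF /allP H yF yN; apply: contraT => yt.
  have [s [lt ts sF']] := extend_triangle sF t0 tF yF yN yt.
  have /H : s \in cand by apply: candP => //; lia.
  by rewrite sF' ts /=; lia.
have mx_sub s t : mx s -> mx t -> (exists2 x, x \in triangle s & x \in triangle t) ->
    triangle s `<=` triangle t.
  move=> ms mt [x xs xt]; apply/fsubsetP => y; move: y.
  apply: (triangle_nbr_ind xs xt) => y z ys yt zs zy.
  apply: mxP => //; first by case/and3P: ms => _ /fsubsetP/(_ z zs).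
  by apply/in_nbrs_set; exists y.
exists [fset t in cand | mx t]; split=> [|t|s t].
- apply/fsetP => x; apply/idP/in_bigcup => [xF|[t]]; last first.
    by rewrite !inE => /andP[_ /and3P[_ /fsubsetP h _]] /h.
  have ex : exists i, has (fun t : point * nat => [&& t.2 == i, (0 < i)%N, triangle t `<=` F & x \in triangle t]) cand.
    exists 1%N; apply/hasP; exists (x, 1%N); last first.
      apply/and4P; split=> //; last by rewrite in_triangle /=; lia.
      apply/fsubsetP => y; rewrite in_triangle /= => h.
      suff -> : y = x by [].
      by case: x y h {xF} => [a b] [c d] /= h; congr pair; lia.
    apply: candP => //; apply/fsubsetP => y; rewrite in_triangle /= => h.
    suff -> : y = x by [].
    by case: x y h {xF} => [a b] [c d] /= h; congr pair; lia.
  case: (ex_maxnP ex (m := #|` F |)) => [i /hasP[t _ /and4P[/eqP <- _ tF _]]|i].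
    exact: triangle_size.
  case/hasP => t tc /and4P[/eqP ti i0 tF xt] mxi.
  exists t => //; rewrite !inE tc /=; apply/and3P; split=> //; first by rewrite ti.
  apply/allP => s sc; apply/implyP => sF'; apply/implyP => ts.
  rewrite ti leqNgt; apply/negP => lt; suff h : (s.2 <= i)%N.
    by move: (leq_trans lt h); rewrite ltnn.
  apply: mxi; apply/hasP; exists s => //; apply/and4P; split=> //; first exact: leq_ltn_trans lt.
  exact: (fsubsetP ts).
- by rewrite !inE => /andP[_ /and3P[]].
- rewrite !inE => /andP[_ ms] /andP[_ mt] ne; apply/fsetP => y; rewrite !inE.
  apply/negP => /andP[yN yt]; apply: ne.
  have ys : y \in triangle s.
    by apply: mxP => //; case/and3P: mt => _ /fsubsetP/(_ y yt).
  apply: triangle_inj; first by case/and3P: ms.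
  by apply/eqP; rewrite eqEfsubset !mx_sub //; exists y.
Qed.

Lemma decompositionP P : is_decomposition (filling P) (decomposition (filling P)).
Proof. by apply: epsilon_spec; apply: decomposition_exists; case: (fillingP P). Qed.

(* Main.v *)
(** Moves are reversible and preserve both the filling and the number of tokens, and the top row
    of T_n fills T_n; this gives one implication.  For the other, a move exchanges the contents
    of two points of a cell v + T whose third point is occupied, so extra tokens never block it.
    First, the three sides of a triangle can be moved into each other, and a triangle with an
    occupied side grows by one as soon as a token is adjacent to it; growing a triangle in this
    way, every pattern that fills T_n reaches one containing the top row.  Second, once the top
    row is occupied, any token below it can be moved to any free point below it: temporarily
    turning a segment of the top row into another side of its triangle produces the tokens that
    control the exchange of two adjacent points. *)
Require Import Defs.
From Stdlib Require Import Relation_Operators Operators_Properties.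
From mathcomp Require Import all_boot all_order all_algebra finmap.
From mathcomp Require Import zify.

Set Implicit Arguments.
Unset Strict Implicit.
Unset Printing Implicit Defensive.

Import GRing.Theory.

Section Solitaire.
Local Open Scope fset_scope.
Local Open Scope ring_scope.

Implicit Types (A B C F P Q S W X Y : pattern) (v w x y : point) (s t : point * nat).

(** * Reversibility and invariants of moves *)

Lemma solitaire_move_sym P Q : solitaire_move P Q -> solitaire_move Q P.
Proof.
case=> v [S] [cP /fsubsetP SV cS ->]; exists v, (P `&` translate v T); split=> //.
- suff -> : (P `\` translate v T `|` S) `&` translate v T = S by [].
  apply/fsetP => x; rewrite !inE; case xV: (x \in translate v T); rewrite ?andbT ?andbF //=.
  by apply/esym/negP => /SV; rewrite xV.
- exact: fsubsetIr.
- apply/fsetP => x; rewrite !inE; case xV: (x \in translate v T); rewrite ?andbT ?andbF ?orbF //=.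
  by case xS: (x \in S); rewrite ?orbF //; move/SV: xS; rewrite xV.
Qed.

Lemma gamma_sym P Q : gamma P Q -> gamma Q P.
Proof.
elim=> [A B /solitaire_move_sym|A|A B C _ h1 _ h2]; [exact: rt_step|exact: rt_refl|].
exact: rt_trans h2 h1.
Qed.

Lemma gamma_trans P Q R : gamma P Q -> gamma Q R -> gamma P R.
Proof. exact: rt_trans. Qed.

Lemma sub_filling P : P `<=` filling P.
Proof. by have [/fill_incr] := fillingP P. Qed.

Lemma stable_filling P : stable (filling P).
Proof. by have [] := fillingP P. Qed.

Lemma filling_sub P F : stable F -> P `<=` F -> filling P `<=` F.
Proof. by have [h _] := fillingP P; apply: fill_sub h. Qed.

(** This confines moves: two points of the cell lie in [F], hence by stability all three, so no move
    leaves a stable set. *)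
Lemma card2_stable_sub A F v : stable F -> A `<=` F -> #|` A `&` translate v T | = 2%N ->
  translate v T `<=` F.
Proof.
move=> /stableP sF /fsubsetP AF cA; apply/fsubsetP => z zV.
have /card_gt1[x [y []]] : (1 < #|` A `&` translate v T |)%N by rewrite cA.
rewrite !inE => /andP[xA xV] /andP[yA yV] /eqP xy.
by apply: (sF v x y) => //; apply: AF.
Qed.

Lemma move_sub A B F : stable F -> A `<=` F -> solitaire_move A B -> B `<=` F.
Proof.
move=> sF AF [v [S [cA SV cS ->]]]; rewrite fsubUset.
rewrite (fsubset_trans (fsubsetDl _ _) AF) /=.
exact: fsubset_trans SV (card2_stable_sub sF AF cA).
Qed.

Lemma gamma_sub A B F : stable F -> A `<=` F -> gamma A B -> B `<=` F.
Proof.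
move=> sF AF AB; elim: AB AF => [{}A {}B AB|//|{}A {}B C _ h1 _ h2] AF.
  exact: move_sub AB.
by apply: h2; apply: h1.
Qed.

(** The filling of [A] is stable, so it contains [B] and then the filling of [B]; reversibility
    gives the other inclusion. *)
Lemma gamma_filling A B : gamma A B -> filling A = filling B.
Proof.
have sub P Q : gamma P Q -> filling Q `<=` filling P.
  move=> PQ; apply: filling_sub (@stable_filling P) _.
  exact: gamma_sub (@stable_filling P) (sub_filling P) PQ.
by move=> AB; apply/eqP; rewrite eqEfsubset !sub //; apply: gamma_sym.
Qed.

Lemma gamma_card A B : gamma A B -> #|` A | = #|` B |.
Proof.
elim=> [{}A {}B|//|{}A {}B C _ -> _ //].
case=> v [S] [cA SV cS ->].
rewrite -(cardfsID (translate v T) A) cA -cS addnC -cardfsUI.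
suff -> : (A `\` translate v T) `&` S = fset0 by rewrite cardfs0 addn0.
apply/fsetP => x; rewrite !inE; apply/negP => /andP[/andP[xV _] xS].
by rewrite (fsubsetP SV) in xV.
Qed.

(* Three tokens in a cell triangle already contain any two-element target, so superfluous tokens
   never block a move. *)
Lemma gamma_mono A B Q : gamma A B -> A `<=` Q -> exists2 Q', gamma Q Q' & B `<=` Q'.
Proof.
move=> AB; elim: AB Q => [{}A {}B|{}A|{}A {}B C _ h1 _ h2].
- case=> v [S] [cA SV cS ->] Q AQ.
  have [VQ|nVQ] := boolP (translate v T `<=` Q).
    exists Q; first exact: rt_refl.
    by rewrite fsubUset (fsubset_trans SV VQ) andbT (fsubset_trans (fsubsetDl _ _) AQ).
  exists ((Q `\` translate v T) `|` S); last by apply: fsetSU; apply: fsetSD.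
  apply: rt_step; exists v, S; split=> //; apply/eqP; rewrite eqn_leq.
  rewrite -{2}cA (fsubset_leq_card (fsetSI _ AQ)) andbT -ltnS -(card_T v).
  by apply: fproper_ltn_card; apply: fproperIr.
- by move=> Q AQ; exists Q => //; exact: rt_refl.
- by move=> Q /h1[Q1 g1 /h2[Q2 g2 CQ]]; exists Q2 => //; apply: gamma_trans g2.
Qed.

(** * Moves beside fixed tokens, and the elementary exchange *)

(** [W] has to avoid only the cell of this move, not a whole stable set: in [first_touch] it may
    meet the stable set inside a triangle. *)
Lemma move_frame A B W v S : #|` A `&` translate v T | = 2%N -> S `<=` translate v T ->
  #|` S | = 2%N -> B = (A `\` translate v T) `|` S ->
  (forall x, x \in W -> x \notin translate v T) -> gamma (A `|` W) (B `|` W).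
Proof.
move=> cA SV cS -> WV; apply: rt_step; exists v, S; split=> //.
  rewrite fsetIUl; suff -> : W `&` translate v T = fset0 by rewrite fsetU0.
  by apply/fsetP => x; rewrite !inE; apply/negP => /andP[/WV/negP].
apply/fsetP => x; rewrite !inE; case xW: (x \in W); rewrite ?orbT ?orbF //.
by rewrite (WV _ xW).
Qed.

Lemma gamma_frame A B F W : stable F -> A `<=` F -> (forall x, x \in W -> x \notin F) ->
  gamma A B -> gamma (A `|` W) (B `|` W).
Proof.
move=> sF AF WF AB; elim: AB AF => [{}A {}B AB|{}A|{}A {}B C AB h1 _ h2] AF.
- case: AB => v [S] [cA SV cS ->]; apply: (move_frame cA SV cS) => // x /WF.
  by apply: contra; apply: (fsubsetP (card2_stable_sub sF AF cA)).
- exact: rt_refl.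
- by apply: gamma_trans (h1 AF) (h2 _); apply: gamma_sub AB.
Qed.

Lemma gamma_frame1 A B t w : A `<=` triangle t -> w \notin triangle t ->
  gamma A B -> gamma (w |` A) (w |` B).
Proof.
move=> At wt AB; rewrite ![w |` _]fsetUC; apply: (gamma_frame (@stable_triangle t)) => //.
by move=> x; rewrite inE => /eqP ->.
Qed.

(** The cell holds exactly the two tokens [a] and [c], so a move with target [b], [c] applies. *)
Lemma gamma_exchange C (a b c : point) v : a \notin C -> b \notin C -> c \in C -> a != b ->
  a \in translate v T -> b \in translate v T -> c \in translate v T ->
  gamma (a |` C) (b |` C).
Proof.
move=> aC bC cC ab aV bV cV.
have ac : a != c by apply: contraNneq aC => ->.
have bc : b != c by apply: contraNneq bC => ->.
have VE : translate v T = [fset a; b; c].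
  apply/esym/eqP; rewrite eqEfcard card_T; apply/andP; split.
    by apply/fsubsetP => x; rewrite !inE => /orP[/orP[]|] /eqP ->.
  by rewrite fsetUC cardfsU1 cardfs2 !inE (eq_sym c) (eq_sym c) ab (negbTE ac) (negbTE bc).
apply: rt_step; exists v, [fset b; c]; rewrite VE; split.
- suff -> : (a |` C) `&` [fset a; b; c] = [fset a; c] by rewrite cardfs2 ac.
  apply/fsetP => x; rewrite !inE; have [->|xa] := eqVneq x a => //=.
  have [->|xb] := eqVneq x b; first by rewrite (negbTE bC) (negbTE bc).
  by have [->|xc] := eqVneq x c; rewrite /= ?cC ?andbF.
- by apply/fsubsetP => x; rewrite !inE => /orP[] ->; rewrite ?orbT.
- by rewrite cardfs2 bc.
- apply/fsetP => x; rewrite !inE; have [->|xb] := eqVneq x b => //=; first by rewrite orbT.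
  have [->|xa] /= := eqVneq x a; first by rewrite (negbTE aC) (negbTE ac).
  by have [->|xc] := eqVneq x c; rewrite /= ?cC ?orbF.
Qed.

Lemma pair_neqE (a b c d : int) : ((a, b) != (c, d) :> point) = (a != c) || (b != d).
Proof. by rewrite xpair_eqE negb_and. Qed.

(** * The sides of a triangle: passing between them, enlarging the triangle, reaching its points *)

Definition row t : pattern := [fset x in triangle t | x.2 == t.1.2 + t.2%:Z - 1].
Definition col t : pattern := [fset x in triangle t | x.1 == t.1.1 + t.2%:Z - 1].
Definition diag t : pattern := [fset x in triangle t | x.1 + x.2 == t.1.1 + t.1.2 + t.2%:Z - 1].

Lemma in_row t x : (x \in row t) =
  [&& t.1.1 <= x.1, x.1 <= t.1.1 + t.2%:Z - 1 & x.2 == t.1.2 + t.2%:Z - 1].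
Proof. by rewrite !inE in_triangle; case: t x => [[a b] k] [c d] /=; lia. Qed.

Lemma in_col t x : (x \in col t) =
  [&& t.1.2 <= x.2, x.2 <= t.1.2 + t.2%:Z - 1 & x.1 == t.1.1 + t.2%:Z - 1].
Proof. by rewrite !inE in_triangle; case: t x => [[a b] k] [c d] /=; lia. Qed.

Lemma in_diag t x : (x \in diag t) =
  [&& t.1.1 <= x.1, x.1 <= t.1.1 + t.2%:Z - 1 & x.1 + x.2 == t.1.1 + t.1.2 + t.2%:Z - 1].
Proof. by rewrite !inE in_triangle; case: t x => [[a b] k] [c d] /=; lia. Qed.

Lemma row_sub t : row t `<=` triangle t.
Proof. by apply/fsubsetP => x; rewrite !inE => /andP[]. Qed.

Lemma col_sub t : col t `<=` triangle t.
Proof. by apply/fsubsetP => x; rewrite !inE => /andP[]. Qed.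

Lemma diag_sub t : diag t `<=` triangle t.
Proof. by apply/fsubsetP => x; rewrite !inE => /andP[]. Qed.

Lemma gamma_chain (f : int -> pattern) (p : int) (m : nat) :
  (forall r, p <= r -> r < p + m%:Z -> gamma (f r) (f (r + 1))) ->
  forall q r, p <= q -> q <= p + m%:Z -> p <= r -> r <= p + m%:Z -> gamma (f q) (f r).
Proof.
move=> H q r q1 q2; move: r.
apply: (zind q1 q2 (B := fun r => gamma (f q) (f r))) => [|r r1 r2]; first exact: rt_refl.
split=> h; apply: gamma_trans h _; first exact: H.
by apply: gamma_sym; apply: H.
Qed.

(** Consecutive positions on the line above the row share a cell whose third point is on the row, so
    a row of [k] tokens serves as a track with [k + 1] positions. The next two lemmas do the same
    along the other sides. *)
Lemma slide_above (a b : int) (k : nat) (x x' : int) :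
  a - 1 <= x -> x <= a - 1 + k%:Z -> a - 1 <= x' -> x' <= a - 1 + k%:Z ->
  gamma ((x, b + k%:Z) |` row ((a, b), k)) ((x', b + k%:Z) |` row ((a, b), k)).
Proof.
move=> h1 h2 h3 h4.
apply: (@gamma_chain (fun x : int => (x, b + k%:Z) |` row ((a, b), k)) (a - 1) k) =>
  // {h1 h2 h3 h4} {}x h1 h2.
by apply: (@gamma_exchange _ _ _ (x + 1, b + k%:Z - 1) (x, b + k%:Z - 1));
  rewrite ?in_row ?in_translateT ?pair_neqE /=; lia.
Qed.

Lemma slide_right (a b : int) (k : nat) (y y' : int) :
  b - 1 <= y -> y <= b - 1 + k%:Z -> b - 1 <= y' -> y' <= b - 1 + k%:Z ->
  gamma ((a + k%:Z, y) |` col ((a, b), k)) ((a + k%:Z, y') |` col ((a, b), k)).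
Proof.
move=> h1 h2 h3 h4.
apply: (@gamma_chain (fun y : int => (a + k%:Z, y) |` col ((a, b), k)) (b - 1) k) =>
  // {h1 h2 h3 h4} {}y h1 h2.
by apply: (@gamma_exchange _ _ _ (a + k%:Z - 1, y + 1) (a + k%:Z - 1, y));
  rewrite ?in_col ?in_translateT ?pair_neqE /=; lia.
Qed.

Lemma slide_below (a b : int) (k : nat) (x x' : int) :
  a - 1 <= x -> x <= a - 1 + k%:Z -> a - 1 <= x' -> x' <= a - 1 + k%:Z ->
  gamma ((x, a + b + k%:Z - 2 - x) |` diag ((a, b), k))
        ((x', a + b + k%:Z - 2 - x') |` diag ((a, b), k)).
Proof.
move=> h1 h2 h3 h4.
apply: (@gamma_chain (fun x : int => (x, a + b + k%:Z - 2 - x) |` diag ((a, b), k)) (a - 1) k) =>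
  // {h1 h2 h3 h4} {}x h1 h2.
by apply: (@gamma_exchange _ _ _ (x + 1, a + b + k%:Z - 2 - x) (x, a + b + k%:Z - 3 - x));
  rewrite ?in_diag ?in_translateT ?pair_neqE /=; lia.
Qed.

(* A side of the triangle of size k.+1 is a side of a subtriangle of size k plus one point, and
   that point slides along the subtriangle once its tokens have been moved to the facing side. *)
Lemma row_lines (k : nat) v : gamma (row (v, k)) (col (v, k)) /\ gamma (row (v, k)) (diag (v, k)).
Proof.
elim: k v => [|k IH] [a b].
  have E0 : row ((a, b), 0%N) = fset0.
    by apply/fsetP => x; rewrite in_row in_fset0 /=; lia.
  have -> : col ((a, b), 0%N) = fset0.
    by apply/fsetP => x; rewrite in_col in_fset0 /=; lia.
  have -> : diag ((a, b), 0%N) = fset0.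
    by apply/fsetP => x; rewrite in_diag in_fset0 /=; lia.
  by rewrite E0; split; apply: rt_refl.
split.
(* The subtriangle [t1] omits the corner [(a, b + k)] of the row and the corner [(a + k, b)] of the
   column; both are written in the form required by [slide_below]. *)
- have [h1 h2] := IH (a + 1, b + 1); set t1 := ((a + 1, b + 1), k) in h1 h2.
  have -> : row ((a, b), k.+1) = (a, a + 1 + (b + 1) + k%:Z - 2 - a) |` row t1.
    by apply/fsetP => -[x y]; rewrite in_fset1U !in_row xpair_eqE /=; lia.
  have -> : col ((a, b), k.+1) = (a + k%:Z, a + 1 + (b + 1) + k%:Z - 2 - (a + k%:Z)) |` col t1.
    by apply/fsetP => -[x y]; rewrite in_fset1U !in_col xpair_eqE /=; lia.
  apply: (@gamma_trans _ ((a, a + 1 + (b + 1) + k%:Z - 2 - a) |` diag t1)).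
    by apply: (@gamma_frame1 _ _ t1); rewrite ?row_sub // in_triangle /=; lia.
  apply: gamma_trans (@slide_below (a + 1) (b + 1) k a (a + k%:Z) _ _ _ _) _; try lia.
  apply: (@gamma_frame1 _ _ t1); rewrite ?diag_sub //; first by rewrite in_triangle /=; lia.
  by apply: gamma_trans h1; apply: gamma_sym.
- have [h1 h2] := IH (a, b + 1); set t2 := ((a, b + 1), k) in h1 h2.
  have -> : row ((a, b), k.+1) = (a + k%:Z, b + k%:Z) |` row t2.
    by apply/fsetP => -[x y]; rewrite in_fset1U !in_row xpair_eqE /=; lia.
  have -> : diag ((a, b), k.+1) = (a + k%:Z, b) |` diag t2.
    by apply/fsetP => -[x y]; rewrite in_fset1U !in_diag xpair_eqE /=; lia.
  apply: (@gamma_trans _ ((a + k%:Z, b + k%:Z) |` col t2)).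
    by apply: (@gamma_frame1 _ _ t2); rewrite ?row_sub // in_triangle /=; lia.
  apply: gamma_trans (@slide_right a (b + 1) k (b + k%:Z) b _ _ _ _) _; try lia.
  apply: (@gamma_frame1 _ _ t2); rewrite ?col_sub //; first by rewrite in_triangle /=; lia.
  by apply: gamma_trans h2; apply: gamma_sym.
Qed.

Lemma row_col t : gamma (row t) (col t).
Proof. by case: t => v k; case: (row_lines k v). Qed.

Lemma row_diag t : gamma (row t) (diag t).
Proof. by case: t => v k; case: (row_lines k v). Qed.

(** A neighbour outside the triangle lies on the line facing one of its sides. The tokens are
    brought to that side, [w] slides to an end of its line, and the tokens turn to the side that [w]
    prolongs to a side of a larger triangle. *)
Lemma extend_row t w : w \in nbrs_set (triangle t) -> w \notin triangle t ->
  exists2 t', t'.2 = t.2.+1 & gamma (w |` row t) (row t').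
Proof.
case: t => [[a b] k] /in_nbrs_set[x xt wx] wt.
have rc := gamma_frame1 (row_sub _) wt (row_col _).
have rd := gamma_frame1 (row_sub _) wt (row_diag _).
have cr := gamma_sym (row_col ((a, b), k)); have dr := gamma_sym (row_diag ((a, b), k)).
case: w wt wx rc rd => [w1 w2] wt wx rc rd; move: (wt) (wx) (xt).
rewrite in_nbrs !in_triangle /= => h1 h2 h3.
have [E|[E|E]] : w1 = a + k%:Z \/ w2 = b + k%:Z \/ w1 + w2 = a + b + k%:Z - 2 by lia.
- exists ((a, b - 1), k.+1) => //; apply: gamma_trans rc _; subst w1.
  apply: gamma_trans (@slide_right a b k w2 (b - 1 + k%:Z) _ _ _ _) _; try lia.
  have -> : row ((a, b - 1), k.+1) = (a + k%:Z, b - 1 + k%:Z) |` row ((a, b), k).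
    by apply/fsetP => -[u z]; rewrite in_fset1U !in_row xpair_eqE /=; lia.
  by apply: (@gamma_frame1 _ _ ((a, b), k)); rewrite ?col_sub // in_triangle /=; lia.
- exists ((a - 1, b), k.+1) => //; subst w2.
  apply: gamma_trans (@slide_above a b k w1 (a - 1 + k%:Z) _ _ _ _) _; try lia.
  apply: (gamma_trans _ (gamma_sym (row_col _))).
  have -> : col ((a - 1, b), k.+1) = (a - 1 + k%:Z, b + k%:Z) |` col ((a, b), k).
    by apply/fsetP => -[u z]; rewrite in_fset1U !in_col xpair_eqE /=; lia.
  apply: (@gamma_frame1 _ _ ((a, b), k)); rewrite ?row_sub // ?in_triangle /=; first lia.
  exact: row_col.
- exists ((a - 1, b - 1), k.+1) => //; apply: gamma_trans rd _.
  have E2 : w2 = a + b + k%:Z - 2 - w1 by lia.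
  subst w2.
  apply: gamma_trans (@slide_below a b k w1 (a - 1) _ _ _ _) _; try lia.
  have -> : row ((a - 1, b - 1), k.+1) = (a - 1, a + b + k%:Z - 2 - (a - 1)) |` row ((a, b), k).
    by apply/fsetP => -[u z]; rewrite in_fset1U !in_row xpair_eqE /=; lia.
  by apply: (@gamma_frame1 _ _ ((a, b), k)); rewrite ?diag_sub // in_triangle /=; lia.
Qed.

(** Off its top row the triangle is a smaller one whose right column is part of the large right
    column; so the row is turned into the column and the induction goes on there. *)
Lemma row_reach t x : x \in triangle t -> exists2 Q, gamma (row t) Q & x \in Q.
Proof.
case: t => v k; elim: k v => [|k IH] [a b] xt; first by move: xt; rewrite in_triangle /=; lia.
have [xr|xr] := boolP (x \in row ((a, b), k.+1)).
  by exists (row ((a, b), k.+1)) => //; apply: rt_refl.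
have [|Q1 g1 xQ1] := IH (a + 1, b).
  by move: xt xr; rewrite in_row !in_triangle /=; lia.
have sub : col ((a + 1, b), k) `<=` col ((a, b), k.+1).
  by apply/fsubsetP => u; rewrite !in_col /=; lia.
have [Q g /fsubsetP Q1Q] := gamma_mono (gamma_trans (gamma_sym (row_col _)) g1) sub.
exists Q; last exact: Q1Q.
exact: gamma_trans (row_col _) g.
Qed.

Lemma card_row t : #|` row t | = t.2.
Proof.
have -> : row t = [fset (t.1.1 + i%:Z, t.1.2 + t.2%:Z - 1) | i in iota 0 t.2].
  apply/fsetP => -[x y]; rewrite in_row /=; apply/idP/imfsetP => /= [h|[i]].
    exists `|x - t.1.1|%N; first by rewrite mem_iota; lia.
    by apply/eqP; rewrite xpair_eqE; lia.
  by rewrite mem_iota => hi [-> ->]; lia.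
rewrite card_imfset /=; last by move=> i j [] /eqP; lia.
by rewrite undup_id ?iota_uniq // size_iota.
Qed.

(** * Growing a triangle up to the whole filling *)

Lemma cell_nbrs v x y : x \in translate v T -> y \in translate v T -> x != y -> y \in nbrs x.
Proof.
by case: v x y => [a b] [c d] [e f]; rewrite !in_translateT in_nbrs pair_neqE /=; lia.
Qed.

(** The moves from [A] to [B] are carried out with [W] present and stopped once a token is adjacent
    to [triangle t]. Before that no cell used meets [triangle t], since one of its two tokens would
    be adjacent to the common point; hence [W] is not disturbed. *)
Lemma first_touch A B F W t c : stable F -> A `<=` F ->
  (forall x, x \in W -> x \in F -> x \in triangle t) -> A `&` triangle t = fset0 ->
  gamma A B -> c \in B -> c \in triangle t `|` nbrs_set (triangle t) ->
  exists C w, [/\ gamma (A `|` W) (C `|` W), w \in C, w \in nbrs_set (triangle t)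
    & w \notin triangle t].
Proof.
move=> sF AF WF At AB cB cZ.
have {}AB := clos_rt_rt1n _ _ _ _ AB; elim: AB AF At cB => [{}A|{}A A1 {}B AA1 _ IH] AF At cB.
  have ct : c \notin triangle t.
    by apply/negP => ct; move/fsetP/(_ c): At; rewrite !inE cB ct.
  by exists A, c; split=> //; [exact: rt_refl|move: cZ; rewrite !inE (negbTE ct)].
have [AN|/fset0Pn[w]] := eqVneq (A `&` nbrs_set (triangle t)) fset0; last first.
  rewrite inE => /andP[wA wN]; exists A, w; split=> //; first exact: rt_refl.
  by apply/negP => wt; move/fsetP/(_ w): At; rewrite !inE wA wt.
have A1F := move_sub sF AF AA1.
case: AA1 IH A1F => v [S] [cA SV cS E] IH A1F.
have Vt x : x \in translate v T -> x \notin triangle t.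
  move=> xV; apply/negP => xt.
  have /card_gt1[y [z []]] : (1 < #|` A `&` translate v T |)%N by rewrite cA.
  rewrite !inE => /andP[yA yV] /andP[zA zV] yz.
  have noN u : u \in A -> u \in translate v T -> x = u.
    move=> uA uV; apply/eqP; apply: contraT => xu.
    suff : u \in A `&` nbrs_set (triangle t) by rewrite AN.
    by rewrite inE uA; apply/in_nbrs_set; exists x => //; apply: (cell_nbrs xV uV).
  by move: yz; rewrite -(noN y) // -(noN z) // eqxx.
have g : gamma (A `|` W) (A1 `|` W).
  apply: (move_frame cA SV cS E) => x xW; apply/negP => xV.
  have xF := fsubsetP (card2_stable_sub sF AF cA) _ xV.
  by have := Vt x xV; rewrite WF.
have [|C [w [gC wC wN wt]]] := IH A1F _ cB; last first.
  by exists C, w; split=> //; apply: gamma_trans gC.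
apply/fsetP => x; rewrite E !inE; apply/negP => /andP[/orP[/andP[_ xA]|/(fsubsetP SV) xV]] xt.
  by move/fsetP/(_ x): At; rewrite !inE xA xt.
by have := Vt x xV; rewrite xt.
Qed.

Lemma decomposition_sep R u x y : u \in decomposition (filling R) -> x \in triangle u ->
  y \in filling R -> y \notin triangle u -> y \notin nbrs x.
Proof.
case: (decompositionP R) => E _ sep uD xu yR yu; apply/negP => yx.
have : y \in \bigcup_(t <- decomposition (filling R)) triangle t by rewrite -E.
case/in_bigcup => u' u'D yu'.
have : y \in nbrs_set (triangle u) `&` triangle u'.
  by rewrite inE yu' andbT; apply/in_nbrs_set; exists x.
by rewrite sep // => Eu; move: yu; rewrite Eu yu'.
Qed.

(** By separation no cell meets both [triangle u] and the rest of the filling of [R]. So [G]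
    together with that rest is stable, and as it contains [R] it contains all of [triangle u]. *)
Lemma filling_component R u : u \in decomposition (filling R) ->
  filling (R `&` triangle u) = triangle u.
Proof.
move=> uD; have [E _ _] := decompositionP R.
have uR : triangle u `<=` filling R.
  by apply/fsubsetP => x xu; rewrite E; apply/in_bigcup; exists u.
set G := filling (R `&` triangle u).
have Gu : G `<=` triangle u := filling_sub (@stable_triangle u) (fsubsetIr _ _).
apply/eqP; rewrite eqEfsubset Gu /=.
suff H : filling R `<=` G `|` (filling R `\` triangle u).
  apply/fsubsetP => x xu; have := fsubsetP (fsubset_trans uR H) x xu.
  by rewrite !inE xu /= orbF.
apply: filling_sub; last first.
  apply/fsubsetP => x xR; rewrite !inE.
  have [xu|xu] := boolP (x \in triangle u); last by rewrite (fsubsetP (sub_filling R)) // orbT.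
  by apply/orP; left; apply: (fsubsetP (sub_filling _)); rewrite inE xR.
have sG := @stable_filling (R `&` triangle u); have sR := @stable_filling R.
have GR x : x \in G -> x \in filling R by move=> /(fsubsetP Gu) /(fsubsetP uR).
have sep x y v : x \in translate v T -> y \in translate v T -> x \in triangle u ->
    y \in filling R -> y \in triangle u.
  move=> xV yV xu yR; apply: contraT => yu.
  have := decomposition_sep uD xu yR yu; rewrite (cell_nbrs xV yV) //.
  by apply: contraNneq yu => <-.
apply/stableP => v x y z [xV yV zV] xy xF yF.
have inR p : p \in G `|` (filling R `\` triangle u) -> p \in filling R.
  by rewrite !inE => /orP[/GR|/andP[]].
have zR : z \in filling R.
  by move/stableP: sR => /(_ v x y z); apply=> //; apply: inR.
rewrite !inE zR andbT; have [zu|//] := boolP (z \in triangle u); last by rewrite orbT.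
have inG p : p \in translate v T -> p \in G `|` (filling R `\` triangle u) -> p \in G.
  move=> pV pF; have pu := sep z p v zV pV zu (inR _ pF).
  by move: pF; rewrite !inE pu orbF.
by rewrite orbF; move/stableP: sG => /(_ v x y z); apply=> //; apply: inG.
Qed.

Lemma row_filling t Q : row t `<=` Q -> triangle t `<=` filling Q.
Proof.
move=> tQ; apply/fsubsetP => c /row_reach[Q1 g cQ1].
have [Q2 g2 Q12] := gamma_mono g tQ.
by rewrite (gamma_filling g2); apply: (fsubsetP (sub_filling _)); apply: (fsubsetP Q12).
Qed.

(** Otherwise [triangle t] and the filling of the outside tokens form a stable set containing [Q],
    hence [triangle s]. As [triangle s] is connected through neighbours, it would equal
    [triangle t]. *)
Lemma outside_touches Q s t : (0 < s.2)%N -> (0 < t.2)%N -> filling Q = triangle s ->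
  row t `<=` Q -> t <> s ->
  exists2 c, c \in filling (Q `\` triangle t) & c \in triangle t `|` nbrs_set (triangle t).
Proof.
move=> s0 t0 fQ tQ ts; set R := Q `\` triangle t.
have [E|/fset0Pn[c]] := eqVneq (filling R `&` (triangle t `|` nbrs_set (triangle t))) fset0;
  last by rewrite inE => /andP[]; exists c.
have far x y : x \in triangle t -> y \in filling R -> y \notin nbrs x.
  move=> xt yR; apply/negP => yx.
  suff : y \in filling R `&` (triangle t `|` nbrs_set (triangle t)) by rewrite E.
  by rewrite in_fsetI yR in_fsetU; apply/orP; right; apply/in_nbrs_set; exists x.
have farV v x y : x \in translate v T -> y \in translate v T -> x <> y ->
    x \in triangle t -> y \in filling R -> False.
  by move=> xV yV /eqP xy xt yR; have := far x y xt yR; rewrite (cell_nbrs xV yV).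
have sU : stable (triangle t `|` filling R).
  apply/stableP => v x y z [xV yV zV] xy; rewrite !inE.
  case/orP=> hx /orP[] hy.
  - by apply/orP; left; move/stableP: (@stable_triangle t) => /(_ v x y z); apply.
  - by case: (farV v x y).
  - by case: (farV v y x) => // /esym.
  - by apply/orP; right; move/stableP: (@stable_filling R) => /(_ v x y z); apply.
have QU : Q `<=` triangle t `|` filling R.
  apply/fsubsetP => x xQ; rewrite inE; case: (boolP (x \in triangle t)) => //= xt.
  by apply: (fsubsetP (sub_filling R)); rewrite inE xt.
have := filling_sub sU QU; rewrite fQ => sub.
have tsub : triangle t `<=` triangle s by rewrite -fQ; apply: row_filling.
have [x xt] := triangle_neq0 t0.
case: ts; apply: triangle_inj => //; apply/eqP; rewrite eqEfsubset tsub /=.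
apply/fsubsetP; apply: (triangle_nbr_ind (B := fun y => y \in triangle t) (fsubsetP tsub _ xt) xt).
move=> y z ys yt zs zy; have := fsubsetP sub z zs; rewrite inE => /orP[//|zR].
by have := far y z yt zR; rewrite zy.
Qed.

(* Grow a triangle t one of whose sides is occupied. As long as t is not everything, the tokens
   outside t fill a triangle meeting t or its neighbourhood; by induction on the number of tokens
   they can be moved towards t, and the first one that becomes adjacent to t enlarges it. *)
Lemma reach_row P s : (0 < s.2)%N -> filling P = triangle s ->
  exists2 Q, gamma P Q & row s `<=` Q.
Proof.
have [m] := ubnP #|` P |; elim: m P s => // m IH P s ltm s0 fP.
suff main j : forall Q t, (#|` P | - t.2 < j)%N -> gamma P Q -> row t `<=` Q -> (0 < t.2)%N ->
    exists2 Q', gamma P Q' & row s `<=` Q'.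
  (* Growth starts from the triangle of size 1 at some token; [P] is nonempty because the empty set
     is stable. *)
  have /fset0Pn[p pP] : P != fset0.
    apply/eqP => P0; have [x] := triangle_neq0 s0; rewrite -fP P0.
    have st0 : stable fset0 by apply/stableP => v a b c _ _; rewrite inE.
    by move/(fsubsetP (filling_sub st0 (fsub0set fset0))); rewrite inE.
  apply: (main _ P (p, 1%N) (ltnSn _)) => //; first exact: rt_refl.
  apply/fsubsetP => x; rewrite in_row /= => h; suff -> : x = p by [].
  by case: x p h {pP} => [a b] [c d] /= h; congr pair; lia.
elim: j => // j IHj Q t ltj PQ tQ t0.
have [<-|/eqP ts] := eqVneq t s; first by exists Q.
have fQ : filling Q = triangle s by rewrite -(gamma_filling PQ).
have [c cR cZ] := outside_touches s0 t0 fQ tQ ts; set R := Q `\` triangle t in cR.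
have [E Dpos _] := decompositionP R.
have [u uD cu] : exists2 u, u \in decomposition (filling R) & c \in triangle u.
  by apply/in_bigcup; rewrite -E.
have fB := filling_component uD; set B := R `&` triangle u in fB.
have RQ : (#|` B | < #|` P |)%N.
  rewrite (gamma_card PQ); apply: fproper_ltn_card.
  rewrite fproperE (fsubset_trans (fsubsetIl _ _) (fsubsetDl _ _)) /=.
  have /fset0Pn[r rt] : row t != fset0 by rewrite -cardfs_gt0 card_row.
  apply/fsubsetPn; exists r; first exact: (fsubsetP tQ).
  by rewrite !inE (fsubsetP (row_sub t) _ rt).
(* The outer induction applies to [B], which lacks the tokens on the row of [t]; from the row of [u]
   a token then reaches [c]. *)
have [|Q1 BQ1 uQ1] := IH B u _ (Dpos _ uD) fB; first exact: leq_trans RQ _.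
have [Q2 uQ2 cQ2] := row_reach cu.
have [Q3 Q13 Q23] := gamma_mono uQ2 uQ1.
(* The tokens of [Q] not in [B]. Those in [triangle u] all lie in [triangle t], as [first_touch]
   demands. *)
pose W := (Q `&` triangle t) `|` (R `\` triangle u).
have QE : Q = B `|` W.
  apply/fsetP => x; rewrite !inE.
  by case: (x \in Q); case: (x \in triangle t); case: (x \in triangle u).
have [||||||C [w [gC wC wN wt]]] := @first_touch B Q3 (triangle u) W t c (@stable_triangle u).
- exact: fsubsetIr.
- by move=> x; rewrite !inE => /orP[/andP[]|/andP[/negbTE->]].
- by apply/fsetP => x; rewrite !inE; case: (x \in triangle t); rewrite ?andbF.
- exact: gamma_trans BQ1 Q13.
- exact: (fsubsetP Q23).
- by [].
rewrite -QE in gC; have [t' t'E gt'] := extend_row wN wt.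
have sub : w |` row t `<=` C `|` W.
  apply/fsubsetP => x; rewrite in_fset1U => /orP[/eqP ->|xt]; first by rewrite inE wC.
  by rewrite !inE (fsubsetP tQ _ xt) (fsubsetP (row_sub t) _ xt) !orbT.
have [Q4 g4 t'Q4] := gamma_mono gt' sub.
have PQ4 := gamma_trans PQ (gamma_trans gC g4).
apply: (IHj Q4 t') => //; last by rewrite t'E.
(* Subtraction is truncated; the row of [t'] consists of [t'.2] tokens, so [t.2] is less than the
   number of tokens and the measure drops. *)
have := fsubset_leq_card t'Q4; rewrite card_row -(gamma_card PQ4) t'E; move: ltj; clear; lia.
Qed.

(** * Moving tokens below an occupied top row *)

(* Bring the tokens of triangle f to the line L', exchange a and b using L', and undo. *)
Lemma exchange_beside f L' Q (a b c : point) v : gamma (row f) L' -> row f `<=` Q ->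
  a \in Q -> b \notin Q -> a \notin triangle f -> b \notin triangle f -> c \in L' ->
  a \in translate v T -> b \in translate v T -> c \in translate v T ->
  gamma Q (b |` (Q `\ a)).
Proof.
move=> gL fQ aQ bQ af bf cL aV bV cV.
have ab : a != b by apply: contraNneq bQ => <-.
(* [X] is rearranged with the extra token at [a] and restored with it at [b]; [Y] stays fixed
   throughout. *)
pose X := Q `&` triangle f; pose Y := (Q `\` triangle f) `\ a.
have fX : row f `<=` X by rewrite fsubsetI fQ row_sub.
have [X1 g L1] := gamma_mono gL fX.
have Xf : X `<=` triangle f := fsubsetIr _ _.
have X1f := gamma_sub (@stable_triangle f) Xf g.
have frame (p : point) : p \notin triangle f -> gamma (X `|` (p |` Y)) (X1 `|` (p |` Y)).
  move=> pf; apply: (gamma_frame (@stable_triangle f) Xf) g => x.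
  by rewrite !inE => /orP[/eqP ->|/and3P[]].
have -> : b |` (Q `\ a) = X `|` (b |` Y).
  apply/fsetP => x; rewrite !inE; have [->|xa] /= := eqVneq x a.
    by rewrite (negbTE ab) (negbTE af) andbF.
  by case: (x == b); case: (x \in Q); case: (x \in triangle f).
have {1}-> : Q = X `|` (a |` Y).
  apply/fsetP => x; rewrite !inE; have [->|xa] /= := eqVneq x a.
    by rewrite aQ orbT.
  by case: (x \in Q); case: (x \in triangle f).
apply: gamma_trans (frame a af) _; apply: gamma_trans (gamma_sym (frame b bf)).
rewrite !(fsetUCA X1); apply: (@gamma_exchange _ a b c v) => //.
- by rewrite !inE eqxx orbF; apply: contra af; apply: (fsubsetP X1f).
- by rewrite !inE (negbTE bQ) !andbF orbF; apply: contra bf; apply: (fsubsetP X1f).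
- by rewrite inE (fsubsetP L1).
Qed.

(** Quantifying over all [Q] makes this an equivalence relation on the points off [L], so paths can
    be composed from single exchanges. *)
Definition movable L (a b : point) : Prop :=
  [/\ a \notin L, b \notin L
    & forall Q, L `<=` Q -> a \in Q -> b \notin Q -> gamma Q (b |` (Q `\ a))].

Lemma sub_exchange L Q (a b : point) : a \notin L -> L `<=` Q -> L `<=` b |` (Q `\ a).
Proof.
move=> aL /fsubsetP LQ; apply/fsubsetP => x xL; rewrite !inE (LQ x xL) andbT.
by apply/orP; right; apply: contraNneq aL => <-.
Qed.

Lemma movable_refl L (a : point) : a \notin L -> movable L a a.
Proof. by move=> aL; split=> // Q _ ->. Qed.

Lemma movable_sym L (a b : point) : movable L a b -> movable L b a.
Proof.
case=> aL bL H; split=> // Q LQ bQ aQ.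
have ab : a != b by apply: contraNneq aQ => ->.
apply: gamma_sym; have {2}-> : Q = b |` ((a |` (Q `\ b)) `\ a).
  apply/fsetP => x; rewrite !inE; have [->|xb] /= := eqVneq x b; first by rewrite bQ.
  by have [->|xa] := eqVneq x a; rewrite // (negbTE aQ).
apply: H; first exact: sub_exchange.
  by rewrite !inE eqxx.
by rewrite !inE eqxx eq_sym (negbTE ab).
Qed.

(* A token sitting at the intermediate cell b goes first and is replaced by the one from a. *)
Lemma movable_trans L (a b c : point) : movable L a b -> movable L b c -> movable L a c.
Proof.
move=> [aL bL Hab] [_ cL Hbc]; split=> // Q LQ aQ cQ.
have ac : a != c by apply: contraNneq cQ => <-.
have [E|ab] := eqVneq a b; first by rewrite E in aQ *; apply: Hbc.
have [E|bc] := eqVneq b c; first by rewrite -E; apply: Hab; rewrite // E.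
have [bQ|bQ] := boolP (b \in Q).
  apply: gamma_trans (Hbc Q LQ bQ cQ) _.
  have -> : c |` (Q `\ a) = b |` ((c |` (Q `\ b)) `\ a).
    apply/fsetP => x; rewrite !inE; have [->|xb] /= := eqVneq x b.
      by rewrite bQ (eq_sym b a) ab orbT.
    by have [->|xa] := eqVneq x a; rewrite ?(negbTE ac).
  apply: Hab; first exact: sub_exchange.
    by rewrite !inE ab aQ orbT.
  by rewrite !inE eqxx (negbTE bc).
apply: gamma_trans (Hab Q LQ aQ bQ) _.
have -> : c |` (Q `\ a) = c |` ((b |` (Q `\ a)) `\ b).
  apply/fsetP => x; rewrite !inE; have [->|xb] //= := eqVneq x b.
  by rewrite (negbTE bQ) andbF.
apply: Hbc; first exact: sub_exchange.
  by rewrite !inE eqxx.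
by rewrite !inE (negbTE cQ) (eq_sym c b) (negbTE bc) andbF.
Qed.

(** The first [x] points of the top row become the column at abscissa [x - 1]. It reaches down to
    height [n - x], which is at most [y + 1], and so contains the control point [(x - 1, y + 1)]. *)
Lemma movable_up (n : nat) (x y : int) : (x, y) \in Tn n -> y < n%:Z - 2 ->
  movable (row ((0, 0), n)) (x, y) (x, y + 1).
Proof.
rewrite in_Tn /= => h hy; split; rewrite ?in_row /=; try lia.
move=> Q LQ aQ bQ.
apply: (@exchange_beside ((0, n%:Z - x), `|x|%N) _ _ _ _ (x - 1, y + 1) (x - 1, y) (row_col _));
  rewrite ?in_col ?in_triangle ?in_translateT //=; try lia.
by apply: fsubset_trans LQ; apply/fsubsetP => z; rewrite !in_row /=; lia.
Qed.

Lemma movable_diag (n : nat) (x y : int) : (x, y) \in Tn n -> y < n%:Z - 2 ->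
  movable (row ((0, 0), n)) (x, y) (x - 1, y + 1).
Proof.
rewrite in_Tn /= => h hy; split; rewrite ?in_row /=; try lia.
move=> Q LQ aQ bQ.
(* With this [p], the last [m] points of the top row become the antidiagonal of coordinate sum
   [x + y + 1], which contains the control point [(x, y + 1)]. *)
pose p := x + y + 2 - n%:Z; pose m := absz (n%:Z - p).
apply: (@exchange_beside ((p, p), m) _ _ _ _ (x, y + 1) (x - 1, y) (row_diag _));
  rewrite ?in_diag ?in_triangle ?in_translateT /p /m //=; try lia.
by apply: fsubset_trans LQ; apply/fsubsetP => z; rewrite !in_row /=; lia.
Qed.

(** The token climbs to height [n - 2], then zigzags right: down to [(x + 1, y - 1)] and up again.
    The weight 2 on the first coordinate makes both kinds of step decrease the measure. *)
Lemma movable_corner (n : nat) (x y : int) : (x, y) \in Tn n -> y < n%:Z - 1 ->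
  movable (row ((0, 0), n)) (x, y) (n%:Z - 1, n%:Z - 2).
Proof.
have [m] := ubnP (absz (2 * (n%:Z - x) + (n%:Z - y))).
elim: m x y => // m IH x y hm xT hy; have := xT; rewrite in_Tn /= => h.
have [h1|h1] : y < n%:Z - 2 \/ y = n%:Z - 2 by lia.
  apply: movable_trans (movable_up xT h1) (IH _ _ _ _ _); rewrite ?in_Tn /=; lia.
have [h2|h2] : x < n%:Z - 1 \/ x = n%:Z - 1 by lia.
  apply: (@movable_trans _ _ (x + 1, y - 1)); last first.
    by apply: IH; rewrite ?in_Tn /=; lia.
  have xT' : (x + 1, y - 1) \in Tn n by rewrite in_Tn /=; lia.
  have := movable_sym (movable_diag xT' _); rewrite addrK subrK; apply; lia.
by rewrite h1 h2; apply: movable_refl; rewrite in_row /=; lia.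
Qed.

(** Equal cardinality pairs a token outside [Q'] with a free point of [Q']. The corner links the
    two, and the exchange lowers the number of misplaced tokens. *)
Lemma rearrange (n : nat) Q Q' : row ((0, 0), n) `<=` Q -> row ((0, 0), n) `<=` Q' ->
  Q `<=` Tn n -> Q' `<=` Tn n -> #|` Q | = #|` Q' | -> gamma Q Q'.
Proof.
set L := row _ => LQ LQ' QT Q'T.
have [m] := ubnP #|` Q `\` Q' |; elim: m Q LQ QT => // m IH Q LQ QT hm cQ.
have [E|/fset0Pn[a]] := eqVneq (Q `\` Q') fset0.
  have -> : Q = Q'; last exact: rt_refl.
  by apply/eqP; rewrite eqEfcard cQ leqnn andbT -fsetD_eq0 E.
rewrite inE => /andP[aQ' aQ].
have /fset0Pn[b] : Q' `\` Q != fset0.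
  rewrite -cardfs_gt0; have := cardfsID Q Q'; have := cardfsID Q' Q; rewrite fsetIC cQ => <-.
  have : (0 < #|` Q `\` Q' |)%N by rewrite cardfs_gt0; apply/fset0Pn; exists a; rewrite inE aQ'.
  lia.
rewrite inE => /andP[bQ bQ'].
have aL : a \notin L by apply: contra aQ'; apply: (fsubsetP LQ').
have bL : b \notin L by apply: contra bQ; apply: (fsubsetP LQ).
have corner (x : point) : x \in Tn n -> x \notin L -> movable L x (n%:Z - 1, n%:Z - 2).
  by case: x => x y xT xL; apply: movable_corner => //; move: xT xL; rewrite in_Tn in_row /=; lia.
have [_ _ H] := movable_trans (corner a (fsubsetP QT _ aQ) aL)
  (movable_sym (corner b (fsubsetP Q'T _ bQ') bL)).
have g := H Q LQ aQ bQ; apply: (gamma_trans g); apply: IH.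
- exact: sub_exchange.
- apply/fsubsetP => x; rewrite in_fset1U in_fsetD1 => /orP[/eqP ->|/andP[_]].
    exact: (fsubsetP Q'T).
  exact: (fsubsetP QT).
- move: hm; rewrite (cardfsD1 a (Q `\` Q')) in_fsetD aQ aQ' add1n ltnS; apply: leq_ltn_trans.
  apply: fsubset_leq_card; apply/fsubsetP => x; rewrite !inE.
  by have [->|xb] /= := eqVneq x b; [rewrite bQ'|case/and3P=> -> -> ->].
- by rewrite -(gamma_card g).
Qed.

(** * Size, filling and excess of the patterns [Pnk n k] *)

Lemma triangle0 (n : nat) : triangle ((0, 0), n) = Tn n.
Proof. by apply/fsetP => x; rewrite in_triangle in_Tn /=; lia. Qed.

Lemma top_rowE (n : nat) : top_row n = row ((0, 0), n).
Proof.
apply/fsetP => -[x y]; rewrite in_row /= !inE; apply/mapP/idP => /= [[i]|h].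
  by rewrite mem_iota => hi [-> ->]; lia.
exists `|x|%N; first by rewrite mem_iota; lia.
by apply/eqP; rewrite xpair_eqE; lia.
Qed.

Lemma card_triangle t : (#|` triangle t | * 2 = t.2 * t.2.+1)%N.
Proof.
case: t => v k /=; elim: k v => [|k IH] [a b].
  suff -> : triangle ((a, b), 0%N) = fset0 by rewrite cardfs0.
  by apply/fsetP => x; rewrite in_triangle in_fset0 /=; lia.
have -> : triangle ((a, b), k.+1) = row ((a, b), k.+1) `|` triangle ((a + 1, b), k).
  by apply/fsetP => x; rewrite in_fsetU in_row !in_triangle /=; lia.
have := cardfsUI (row ((a, b), k.+1)) (triangle ((a + 1, b), k)).
have -> : row ((a, b), k.+1) `&` triangle ((a + 1, b), k) = fset0.
  by apply/fsetP => x; rewrite in_fsetI in_row in_triangle in_fset0 /=; lia.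
rewrite cardfs0 addn0 card_row => ->; have := IH (a + 1, b) => /=; nia.
Qed.

Lemma mem_below_top (n : nat) x : (x \in below_top n) = (x \in Tn n) && (x.2 < n%:Z - 1).
Proof.
rewrite mem_filter; case xT: (x \in Tn n) => //=.
apply/allpairsP/idP => [[[j i] /= []]|h].
  by rewrite !mem_rev !mem_iota => hj hi -> /=; lia.
move: xT; rewrite in_Tn => xT; exists (`|x.2|%N, `|x.1|%N) => /=.
rewrite !mem_rev !mem_iota; split; [lia|lia|].
by case: x h xT => a b /= h xT; apply/eqP; rewrite xpair_eqE; lia.
Qed.

Lemma below_top_uniq (n : nat) : uniq (below_top n).
Proof.
apply: filter_uniq; apply: allpairs_uniq; rewrite ?rev_uniq ?iota_uniq //.
by move=> [j i] [j' i'] _ _ /= [-> ->].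
Qed.

(** Below its top row, [Tn n] is the triangle of size [n - 1] at [(1, 0)]. *)
Lemma size_below_top (n : nat) : size (below_top n) = ((n * (n - 1)) %/ 2)%N.
Proof.
have -> : size (below_top n) = #|` triangle ((1, 0), n.-1) |.
  rewrite -(undup_id (below_top_uniq n)) -card_fseq; congr (#|` _ |).
  by apply/fsetP => x; rewrite inE mem_below_top in_Tn in_triangle /=; lia.
have := card_triangle ((1, 0), n.-1) => /= E.
have -> : (n * (n - 1))%N = (#|` triangle ((1, 0)%R, n.-1) | * 2)%N by rewrite E; nia.
by rewrite mulnK.
Qed.

Lemma card_Pnk (n k : nat) : (k <= (n * (n - 1)) %/ 2)%N -> #|` Pnk n k | = (n + k)%N.
Proof.
move=> hk; rewrite /Pnk; set E := [fset x in _].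
have EB x : x \in E -> x \in below_top n by rewrite inE => /mem_take.
have := cardfsUI (top_row n) E.
have -> : top_row n `&` E = fset0.
  apply/fsetP => x; rewrite in_fsetI in_fset0 top_rowE in_row.
  by apply/negP => /andP[h /EB]; rewrite mem_below_top /= in h *; lia.
rewrite cardfs0 addn0 top_rowE card_row => ->; congr (_ + _)%N.
by rewrite card_fseq undup_id ?take_uniq ?below_top_uniq // size_takel // size_below_top.
Qed.

Lemma row_sub_Pnk (n k : nat) : row ((0, 0), n) `<=` Pnk n k.
Proof. by rewrite -top_rowE fsubsetUl. Qed.

Lemma Pnk_sub (n k : nat) : Pnk n k `<=` Tn n.
Proof.
rewrite fsubUset top_rowE -{1}triangle0 row_sub /=; apply/fsubsetP => x.
by rewrite inE => /mem_take; rewrite mem_below_top => /andP[].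
Qed.

Lemma filling_Pnk (n k : nat) : filling (Pnk n k) = Tn n.
Proof.
apply/eqP; rewrite eqEfsubset -triangle0 row_filling ?row_sub_Pnk // andbT.
by apply: filling_sub; [exact: stable_triangle|rewrite triangle0 Pnk_sub].
Qed.

Lemma excess_triangle (n : nat) P : (0 < n)%N -> filling P = Tn n -> excess P = #|` P |%:Z - n%:Z.
Proof.
move=> n0 fP; rewrite /excess; suff <- : [fset ((0, 0) : point, n)] = decomposition (filling P).
  by rewrite big_seq_fset1.
apply: decomposition_unique (decompositionP P); rewrite fP; split=> [|t|s t].
- by rewrite big_seq_fset1 triangle0.
- by rewrite inE => /eqP ->.
- by rewrite !inE => /eqP -> /eqP ->.
Qed.

End Solitaire.

Theorem theorem2 (n k : nat) (hn : (1 <= n)%N) (hk : (k <= (n * (n - 1)) %/ 2)%N)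
  (P : pattern) :
  gamma (Pnk n k) P <-> filling P = Tn n /\ excess P = k%:Z%R.
Proof.
split=> [g|[fP eP]].
  have fP : filling P = Tn n by rewrite -(gamma_filling g) filling_Pnk.
  by rewrite fP (excess_triangle hn fP) -(gamma_card g) card_Pnk //; split=> //; lia.
have fP' : filling P = triangle ((0, 0)%R, n) by rewrite triangle0.
have [Q g LQ] := @reach_row P ((0, 0)%R, n) hn fP'.
(* [Q] and [Pnk n k] both contain the top row and lie in [Tn n]; the excess of [P] gives both
   [n + k] tokens. *)
apply: gamma_sym; apply: (gamma_trans g); apply: (@rearrange n) => //.
- exact: row_sub_Pnk.
- by rewrite -fP (gamma_filling g) sub_filling.
- exact: Pnk_sub.
- by rewrite card_Pnk // -(gamma_card g); move: eP; rewrite (excess_triangle hn fP); lia.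
Qed.
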